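(* Let $\mathbb{K}$ be an algebraically closed field of characteristic $0$, let $S=\mathbb{K}[z_1,\ldots,z_r,x_1,\ldots,x_s]$ be a polynomial ring and $A=\mathbb{K}[x_1,\ldots,x_s]$. Let $P,Q_1,\ldots,Q_k\in S$ be forms of positive degree with $Q_1,\ldots,Q_k\in A$, such that $(Q_1,\ldots,Q_k)$ is a reduced complete intersection, $P$ is reduced and $P\notin(x_1,\ldots,x_s)$. Suppose that for all $i\in\{1,\ldots,r\}$ such that $P$ depends on the variable $z_i$, we have $\mathrm{Disc}_{z_i}(P)\notin\mathfrak{q}\cdot S$ for any minimal prime $\mathfrak{q}$ of $(Q_1,\ldots,Q_k)$ in $A$. Then the ideal $(P,Q_1,\ldots,Q_k)$ is radical in $S$.
   Context: A form is a homogeneous polynomial for the standard grading. $P$ reduced means $P$ is square-free. ''$(Q_1,\ldots,Q_k)$ is a reduced complete intersection'' means $Q_1,\ldots,Q_k$ is a regular sequence generating a radical ideal. $\mathrm{Disc}_{z_i}(P)$ denotes the resultant $\mathrm{Res}_{z_i}(P,\partial P/\partial z_i)$ with respect to $z_i$ (an element of the polynomial ring in the remaining variables). *)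

(* Defs.v *)
From HB Require Import structures.
From mathcomp Require Import all_boot all_order all_algebra.
From mathcomp Require Import mpoly.

Set Implicit Arguments.
Unset Strict Implicit.
Unset Printing Implicit Defensive.

Import GRing.Theory.
Local Open Scope ring_scope.

Section Ideals.
Variable R : comNzRingType.

(* Membership in an ideal generated by elements is not decidable in general,
   so generated ideals are Prop-valued. *)
Definition ideal_gen (G : R -> Prop) (f : R) : Prop :=
  exists (n : nat) (c g : 'I_n -> R),
    (forall i, G (g i)) /\ f = \sum_(i < n) c i * g i.

Definition seq_ideal (s : seq R) : R -> Prop := ideal_gen (fun g => g \in s).

Definition radical_ideal (I : R -> Prop) : Prop :=
  forall (f : R) (n : nat), I (f ^+ n) -> I f.

Definition regular_sequence (s : seq R) : Prop :=
  (forall i : nat, (i < size s)%N ->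
     forall f : R, seq_ideal (take i s) (f * s`_i) -> seq_ideal (take i s) f)
  /\ ~ seq_ideal s 1.

Definition reduced_complete_intersection (s : seq R) : Prop :=
  regular_sequence s /\ radical_ideal (seq_ideal s).

(* [idealr_closed] includes properness (1 is not a member). *)
Definition prime_over (I : R -> Prop) (q : {pred R}) : Prop :=
  [/\ idealr_closed q, prime_idealr_closed q & forall f, I f -> f \in q].

Definition minimal_prime (I : R -> Prop) (q : {pred R}) : Prop :=
  prime_over I q /\
  forall p : {pred R}, prime_over I p -> {subset p <= q} -> {subset q <= p}.

End Ideals.

Definition square_free (R : comUnitRingType) (P : R) : Prop :=
  forall f c : R, P = c * f ^+ 2 -> f \is a GRing.unit.

Section Polynomials.
Variable K : fieldType.

(* As 0 is d-homogeneous for every d, this allows P = 0. *)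
Definition form_of_pos_degree (n : nat) (P : {mpoly K[n]}) : Prop :=
  exists2 d : nat, (0 < d)%N & P \is d.-homog.

Definition depends_on (n : nat) (i : 'I_n) (P : {mpoly K[n]}) : Prop :=
  exists2 m, m \in msupp P & (0 < m i)%N.

(* P as a univariate polynomial in its i-th variable.  The coefficients do not
   involve that variable, but are kept in the full polynomial ring. *)
Definition uni_in (n : nat) (i : 'I_n) (P : {mpoly K[n]}) :
    {poly {mpoly K[n]}} :=
  mmap (polyC \o @mpolyC n K)
       (fun j : 'I_n => if j == i then 'X else ('X_j)%:P) P.

Definition Disc (n : nat) (i : 'I_n) (P : {mpoly K[n]}) : {mpoly K[n]} :=
  resultant (uni_in i P) (uni_in i P^`M(i)).

(* In K[z_1..z_r, x_1..x_s] = {mpoly K[r + s]} the first r variables are the z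
   and the last s are the x; [xincl r] is the inclusion of K[x_1..x_s]. *)
Definition zvar (r s : nat) (i : 'I_r) : 'I_(r + s) := lshift s i.
Definition xvar (r s : nat) (j : 'I_s) : 'I_(r + s) := rshift r j.

Definition xincl (r s : nat) (f : {mpoly K[s]}) : {mpoly K[r + s]} :=
  f \mPo [tuple 'X_(xvar r j) | j < s].

Definition x_ideal (r s : nat) : {mpoly K[r + s]} -> Prop :=
  ideal_gen (fun g => exists j : 'I_s, g = 'X_(xvar r j)).

Definition extended_ideal (r s : nat) (q : {pred {mpoly K[s]}}) :
    {mpoly K[r + s]} -> Prop :=
  ideal_gen (fun g => exists2 a, a \in q & g = xincl r a).

End Polynomials.

(* Main.v *)
(* Write A = K[x] and I = (Q_1, ..., Q_k), so that S = A[z].  As P is a form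
   outside (x), its leading coefficient for the graded order on the monomials in
   z is a nonzero constant.  Hence, modulo any ideal of A, division by P in A[z]
   has unique remainders.  Since I is radical, it is the intersection of its
   minimal primes, and by uniqueness of remainders the ideal (P) + I S is the
   intersection of the (P) + q S over the minimal primes q of I.  It remains to
   see that P generates a radical ideal of D[z], where D = A/q.

   Suppose f ^ n is a multiple of P in D[z].  If P involves z_i, its discriminant
   in z_i is nonzero, so P is separable as a polynomial in z_i and u f is a
   multiple of P for some nonzero u free of z_i.  Also, if b f is a multiple
   of P, then so is l ^ M f for some M, where l is the leading coefficient of b in
   z_i.  Starting from b = P and treating all variables in turn gives a nonzero
   constant t in D with t f in (P), and t can be cancelled because P has an
   invertible leading coefficient. *)

Require Import Defs.
From HB Require Import structures.
From mathcomp Require Import all_boot all_order all_algebra.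
From mathcomp Require Import mpoly ring.
From mathcomp Require separable boolp classical_sets.
Set Implicit Arguments.
Unset Strict Implicit.
Unset Printing Implicit Defensive.
Import GRing.Theory.
Local Open Scope ring_scope.

(** * Membership in generated ideals *)

Section GeneratedIdeals.
Variable R : comNzRingType.
Implicit Types (G J : R -> Prop) (x y : R).

(** The coefficient [c] is part of the last premise, so [J] can be a preimage under a morphism and
    need not be shown closed under multiplication. *)
Lemma ideal_gen_sub G J x :
    J 0 -> (forall x y, J x -> J y -> J (x + y)) ->
    (forall c g, G g -> J (c * g)) ->
  ideal_gen G x -> J x.
Proof.
move=> J0 JD JG [n [c [g [Gg ->]]]].
by elim/big_ind: _ => // i _; apply: JG.
Qed.

Lemma ideal_gen0 G : ideal_gen G 0.
Proof.
by exists 0%N, (fun=> 0), (fun=> 0); split=> [[]//|]; rewrite big_ord0.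
Qed.

Lemma ideal_gen_mem G c g : G g -> ideal_gen G (c * g).
Proof.
by move=> Gg; exists 1%N, (fun=> c), (fun=> g); split=> //; rewrite big_ord1.
Qed.

Lemma ideal_genD G x y : ideal_gen G x -> ideal_gen G y -> ideal_gen G (x + y).
Proof.
move=> [n [c [g [Gg ->]]]] [n' [c' [g' [Gg' ->]]]].
exists (n + n')%N, (fun i => match split i with inl j => c j | inr j => c' j end),
  (fun i => match split i with inl j => g j | inr j => g' j end); split.
  by move=> i; case: split.
rewrite big_split_ord /=; congr (_ + _); apply: eq_bigr => i _.
  by rewrite (unsplitK (inl i)).
by rewrite (unsplitK (inr i)).
Qed.

Lemma ideal_gen_sum G (I : Type) (s : seq I) (F : I -> R) :
  (forall i, ideal_gen G (F i)) -> ideal_gen G (\sum_(i <- s) F i).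
Proof.
move=> GF; elim/big_ind: _ => //; [exact: ideal_gen0|exact: ideal_genD].
Qed.

Lemma ideal_genMl G c x : ideal_gen G x -> ideal_gen G (c * x).
Proof.
apply: (ideal_gen_sub (J := fun x => ideal_gen G (c * x))) => [|y z Gy Gz|d g Gg].
- by rewrite mulr0; apply: ideal_gen0.
- by rewrite mulrDr; apply: ideal_genD.
- by rewrite mulrA; apply: ideal_gen_mem.
Qed.

End GeneratedIdeals.

(** * Minimal primes of a radical ideal *)

Section MinimalPrimes.
Variables (R : comNzRingType) (G : R -> Prop).
Local Notation I := (ideal_gen G).
Hypothesis Irad : radical_ideal I.

Let mult_closed (M : R -> Prop) :=
  [/\ M 1, (forall x y, M x -> M y -> M (x * y)) & forall x, M x -> ~ I x].

(** As [I] is radical, no power of [a] lies in [I]; Zorn's lemma enlarges the set of powers of [a]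
    to a maximal multiplicative set disjoint from [I]. *)
Let maximal_mult_closed a : ~ I a ->
  exists M : R -> Prop, [/\ mult_closed M, M a &
    forall N : R -> Prop, mult_closed N -> (forall x, M x -> N x) ->
      forall x, N x -> M x].
Proof.
move=> nIa; pose powers x := exists n, x = a ^+ n.
have powers_closed : mult_closed powers.
  split=> [|_ _ [m ->] [n ->]|_ [n ->] /Irad //]; first by exists 0%N.
  by exists (m + n)%N; rewrite exprD.
have powers_a : powers a by exists 1%N.
(* The empty set is admitted so that the empty chain has an upper bound. *)
pose good (M : R -> Prop) := (forall x, ~ M x) \/ mult_closed M /\ M a.
have [F good_F chain_F|M [good_M max_M]] := @classical_sets.Zorn_bigcup R good.
  have [[M [FM [x Mx]]]|none] :=
      boolp.pselect (exists M, F M /\ exists x, M x); last first.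
    by left=> x [M FM Mx]; apply: none; exists M; split=> //; exists x.
  have goodE N y : F N -> N y -> mult_closed N /\ N a.
    by move=> FN Ny; case: (good_F N FN) => // /(_ y).
  have [[M1 MM MI] Ma] := goodE M x FM Mx.
  right; split; last by exists M.
  split=> [|y z [N FN Ny] [N' FN' Nz]|y [N FN Ny]].
  - by exists M.
  - have [[_ NM _] _] := goodE _ _ FN Ny; have [[_ N'M _] _] := goodE _ _ FN' Nz.
    have [NN'|N'N] := chain_F _ _ FN FN'.
      by exists N' => //; apply: N'M => //; apply: NN'.
    by exists N => //; apply: NM => //; apply: N'N.
  - by have [[_ _ NI] _] := goodE _ _ FN Ny; apply: NI.
have max_good (N : R -> Prop) : good N -> (forall x, M x -> N x) ->
    forall x, N x -> M x.
  move=> goodN MN x Nx; apply: boolp.contrapT => nMx.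
  by apply: (max_M N) => //; split=> // NM; apply/nMx/NM.
case: good_M => [M0|[M_closed Ma]].
  (* The empty set is not maximal, since the powers of [a] contain it. *)
  case: (M0 a); apply: (max_good powers) => [|y /M0//|//].
  by right.
exists M; split=> // N N_closed MN x Nx; apply: max_good Nx => //.
by right; split=> //; apply: MN.
Qed.

(* The complement of a maximal multiplicative set disjoint from [I] is a
   minimal prime; this yields primeness and minimality from a single use of
   Zorn's lemma. *)
Lemma minimal_prime_avoiding a : ~ I a ->
  exists2 q : {pred R}, minimal_prime I q & a \notin q.
Proof.
move=> nIa; have [M [[M1 MM MI] Ma max_M]] := maximal_mult_closed nIa.
(* Adjoining [x] to [M] gives a larger multiplicative set, which must meet [I] in some [m * x ^+ k];
   radicality brings the exponent down to 1. *)
have absorb x : ~ M x -> exists2 m, M m & I (m * x).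
  move=> nMx; apply: boolp.contrapT => no_m; apply: nMx.
  pose N y := exists m n, M m /\ y = m * x ^+ n.
  apply: (max_M N) => [|y My|]; last 2 first.
  - by exists y, 0%N; rewrite mulr1.
  - by exists 1, 1%N; rewrite mul1r.
  split.
  - by exists 1, 0%N; rewrite mulr1.
  - move=> _ _ [m [k [Mm ->]]] [m' [k' [Mm' ->]]].
    exists (m * m'), (k + k')%N; split; first exact: MM.
    by rewrite mulrACA -exprD.
  - move=> _ [m [k [Mm ->]]] Imx; apply: no_m; exists m => //.
    case: k Imx => [|k]; first by rewrite mulr1 => /(MI _ Mm).
    move=> Imx; apply: (@Irad _ k.+1); rewrite exprMn exprS -mulrA.
    by rewrite mulrCA; apply: ideal_genMl.
pose q : {pred R} := fun x => ~~ boolp.asbool (M x).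
have qP x : reflect (~ M x) (x \in q).
  by rewrite unfold_in; apply: (iffP negP) => nM /boolp.asboolP; apply: nM.
have prime_q : prime_over I q.
  split=> [|x y /qP nMxy|f If].
  - split; first by apply/qP => /MI; apply; apply: ideal_gen0.
      by apply/negP => /qP; apply.
    move=> c x y /qP /absorb [m Mm Imx] /qP /absorb [m' Mm' Imy].
    apply/qP => Mxy; apply: (MI _ (MM _ _ (MM _ _ Mm Mm') Mxy)).
    have ->: m * m' * (c * x + y) = (m' * c) * (m * x) + m * (m' * y) by ring.
    by apply: ideal_genD; apply: ideal_genMl.
  - apply/orP; have [Mx|] := boolp.pselect (M x); last by left; apply/qP.
    right; apply/qP => My; apply: nMxy; exact: MM.
  - by apply/qP => Mf; apply: MI If.
exists q; last by apply/negP => /qP.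
(* Minimality: [m * x] lies in [I], hence in [p], while [m] lies in [M] and so outside [p]. *)
split=> // p [[p0 p1 pD] p_prime Ip] pq x /qP /absorb [m Mm Imx].
by case/orP: (p_prime _ _ (Ip _ Imx)) => [/pq/qP|].
Qed.

End MinimalPrimes.

(** * The quotient by a prime ideal as an integral domain *)

Section ClassicalIntegralDomain.
Variable T : comNzRingType.
Hypothesis integral : forall x y : T, x * y = 0 -> (x == 0) || (y == 0).

Let has_inverse (x : T) := exists y, y * x = 1.

Let unit_pred : {pred T} := fun x => boolp.asbool (has_inverse x).

(** An [idomainType] carries an inverse function; classical choice provides it, with the identity as
    default value off the units. *)
Let inverse (x : T) : T :=
  match boolp.pselect (has_inverse x) with
  | left ex => sval (boolp.cid ex)
  | right _ => x
  end.

Let mulVx : {in unit_pred, left_inverse 1 inverse *%R}.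
Proof.
move=> x; rewrite unfold_in /inverse => /boolp.asboolP ux.
by case: boolp.pselect => // ex; case: boolp.cid.
Qed.

Let unitPl x y : y * x = 1 -> unit_pred x.
Proof. by move=> yx; apply/boolp.asboolP; exists y. Qed.

Let inverse_out : {in [predC unit_pred], inverse =1 id}.
Proof.
move=> x; rewrite inE /= unfold_in => /negP nux; rewrite /inverse.
by case: boolp.pselect => // ex; case: nux; apply/boolp.asboolP.
Qed.

Let unit_ring : comUnitRingType := HB.pack (GRing.ComNzRing.sort T)
  (GRing.ComNzRing_hasMulInverse.Build T mulVx unitPl inverse_out).

Definition classical_idomain : idomainType :=
  HB.pack (GRing.ComNzRing.sort T) unit_ring
    (GRing.ComUnitRing_isIntegral.Build unit_ring integral).

End ClassicalIntegralDomain.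

Lemma prime_quotient (R : comNzRingType) (q : {pred R}) :
    idealr_closed q -> prime_idealr_closed q ->
  exists (D : idomainType) (pr : {rmorphism R -> D}),
    forall x, (pr x == 0) = (x \in q).
Proof.
move=> q_ideal q_prime.
pose I : prime_idealr R := HB.pack q (isIdealr.Build R q q_ideal)
  (isPrimeIdealrClosed.Build R q q_prime).
exists (classical_idomain (@Quotient.rquot_IdomainAxiom R I)).
pose pr : {rmorphism R -> Quotient.quot I} := \pi_(Quotient.quot I)%qT.
exists pr => x; have := Quotient.idealrBE I x 0.
by rewrite subr0 => ->; rewrite -(rmorph0 pr).
Qed.

(** * Division by a polynomial with invertible leading coefficient *)

Section DivisionByLeadingTerm.
Import Order.TTheory.
Variables (n : nat) (R : comNzRingType).
Implicit Types (p f g r : {mpoly R[n]}) (m : 'X_{1..n}).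

Definition reduced_mod p r :=
  forall m, m \in msupp r -> ~~ (mlead p <= m)%MM.

(** Induction on the leading monomial of [f]: the leading term is cancelled by a multiple of [p] if
    its monomial is divisible by [mlead p], and goes into the remainder otherwise. *)
Lemma mpoly_division p c f : c * mleadc p = 1 ->
  exists g r, f = g * p + r /\ reduced_mod p r.
Proof.
move=> cp; elim/mleadrect: f => f IH.
have [->|f0] := eqVneq f 0.
  by exists 0, 0; split=> [|m]; rewrite ?mul0r ?addr0 // msupp0.
(* Once the term at [mlead f] is gone, what is left is zero or has a strictly smaller leading
   monomial. *)
have step f1 : (mlead f1 <= mlead f)%O -> f1@_(mlead f) = 0 ->
    exists g r, f1 = g * p + r /\ reduced_mod p r.
  move=> le_f1 f1f; have [->|f10] := eqVneq f1 0.
    by exists 0, 0; split=> [|m]; rewrite ?mul0r ?addr0 // msupp0.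
  apply: IH; rewrite lt_neqAle le_f1 andbT.
  by apply: contraNneq f10 => e; rewrite -mleadc_eq0 e f1f.
have [le_pf|nle_pf] := boolP (mlead p <= mlead f)%MM.
  pose h := (mleadc f * c) *: 'X_[mlead f - mlead p].
  have le_hp : (mlead (h * p) <= mlead f)%O.
    apply: le_trans (mleadM_le _ _) _; rewrite -[X in (_ <= X)%O](submK le_pf).
    by apply: lem_add => //; apply: le_trans (mleadZ_le _ _) _; rewrite mleadXm.
  have [|| g [r [def_f1 red_r]]] := step (f - h * p).
  - by apply: le_trans (mleadB_le _ _) _; rewrite leUx lexx.
  - rewrite mcoeffB -scalerAl mcoeffZ ['X_[_] * p]mulrC.
    rewrite -[X in (p * _)@_X](submK le_pf) mcoeffMX.
    by rewrite -mulrA cp mulr1 subrr.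
  exists (g + h), r; split=> //.
  by rewrite mulrDl addrAC -def_f1 subrK.
have [|| g [r [def_f1 red_r]]] := step (f - mleadc f *: 'X_[mlead f]).
- apply: le_trans (mleadB_le _ _) _; rewrite leUx lexx /=.
  by apply: le_trans (mleadZ_le _ _) _; rewrite mleadXm.
- by rewrite mcoeffB mcoeffZ mcoeffX eqxx mulr1 subrr.
exists g, (r + mleadc f *: 'X_[mlead f]); split.
  by rewrite addrA -def_f1 subrK.
move=> m /msuppD_le; rewrite mem_cat => /orP[/red_r//|/msuppZ_le].
by rewrite msuppX inE => /eqP ->.
Qed.

(** For nonzero [h], invertibility of [mleadc p] makes [mlead h + mlead p] a monomial of [h * p].
    This gives uniqueness of remainders. *)
Lemma reduced_mod_multiple p c h :
  c * mleadc p = 1 -> reduced_mod p (h * p) -> h = 0.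
Proof.
move=> cp red_hp; apply: contraTeq isT => h0.
have lc : mleadc h * mleadc p != 0.
  apply: contra_neq h0 => lc; apply/eqP; rewrite -mleadc_eq0.
  by rewrite -[mleadc h]mulr1 -cp mulrCA lc mulr0.
have := red_hp (mlead (h * p)); rewrite mleadM_proper //.
rewrite lem_addl mcoeff_msupp mleadcM => /(_ lc); exact.
Qed.

End DivisionByLeadingTerm.

(** If [r] is the remainder of [f], then [t *: r] is a reduced multiple of [p], hence zero, and [t]
    cancels in a domain. *)
Lemma dvd_const_multiple n (D : idomainType) (p f h : {mpoly D[n]}) c t :
  c * mleadc p = 1 -> t != 0 -> t *: f = h * p -> exists g, f = g * p.
Proof.
move=> cp t0 def_f; have [g [r [f_gr red_r]]] := mpoly_division f cp.
have def_r : t *: r = (h - t *: g) * p.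
  by rewrite mulrBl -def_f f_gr scalerDr scalerAl addrC addKr.
have h0 : h - t *: g = 0.
  apply: (reduced_mod_multiple cp); rewrite -def_r => m /msuppZ_le; exact: red_r.
exists g; rewrite f_gr; move/eqP: def_r.
by rewrite h0 mul0r mscalerI (negPf t0) => /eqP ->; rewrite addr0.
Qed.

(** * Multivariate polynomials viewed in one variable *)

(* [uni_in] over an arbitrary coefficient ring *)
HB.lock Definition unip (n : nat) (R : comNzRingType) (i : 'I_n)
    (p : {mpoly R[n]}) : {poly {mpoly R[n]}} :=
  mmap (polyC \o @mpolyC n R)
       (fun j : 'I_n => if j == i then 'X else ('X_j)%:P) p.

Section OneVariable.
Variables (n : nat) (R : comNzRingType) (i : 'I_n).
Implicit Types (p q : {mpoly R[n]}) (m : 'X_{1..n}).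
Local Notation unip := (@unip n R i).

Let unip_additive : zmod_morphism unip.
Proof. by move=> p q; rewrite unlock rmorphB. Qed.

Let unip_multiplicative : monoid_morphism unip.
Proof. by split=> [|p q]; rewrite unlock ?rmorph1 ?rmorphM. Qed.

HB.instance Definition _ :=
  GRing.isZmodMorphism.Build {mpoly R[n]} {poly {mpoly R[n]}} unip unip_additive.
HB.instance Definition _ :=
  GRing.isMonoidMorphism.Build {mpoly R[n]} {poly {mpoly R[n]}} unip
    unip_multiplicative.

Lemma unipX m : unip 'X_[m] = ('X_[m - U_(i) *+ m i])%:P * 'X^(m i).
Proof.
rewrite unlock mmapX /mmap1 (bigD1 i) //= eqxx mulrC; congr (_ * _).
rewrite mpolyXE_id rmorph_prod /= [RHS](bigD1 i) //= mnmBE mulmnE mnm1E eqxx.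
rewrite mul1n subnn expr0 mul1r; apply: eq_bigr => j ji.
by rewrite (negPf ji) mnmBE mulmnE mnm1E eq_sym (negPf ji) mul0n subn0 rmorphXn.
Qed.

Lemma unipC c : unip c%:MP = c%:MP%:P.
Proof. by rewrite unlock mmapC. Qed.

Lemma unipZ c p : unip (c *: p) = c%:MP *: unip p.
Proof. by rewrite -mul_mpolyC rmorphM /= unipC mul_polyC. Qed.

Lemma coef_unip p k m :
  (unip p)`_k@_m = if m i == 0%N then p@_(m + U_(i) *+ k) else 0.
Proof.
elim/mpolyind: p => [|c m0 p _ _ IH].
  by rewrite rmorph0 coef0 !mcoeff0 if_same.
rewrite rmorphD coefD mcoeffD IH /= unipZ coefZ unipX coefCM coefXn mul_mpolyC.
rewrite !mcoeffD !mcoeffZ; case: ifP => mi; last first.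
  rewrite addr0; case: eqP => [_|_]; last by rewrite mulr0 mcoeff0 mulr0.
  rewrite mulr1 mcoeffX; case: eqP => [e|]; last by rewrite mulr0.
  by move: mi; rewrite -e mnmBE mulmnE mnm1E eqxx mul1n subnn.
congr (_ + _); congr (_ * _).
have -> : 'X_[m0]@_(m + U_(i) *+ k) = (m0 == (m + U_(i) *+ k)%MM)%:R :> R.
  by rewrite mcoeffX.
case: (eqVneq k (m0 i)) => [->|km].
  rewrite mulr1 mcoeffX; congr (_%:R); congr nat_of_bool.
  apply/eqP/eqP => [<-|e]; last by rewrite {1}e addmK.
  rewrite submK //; apply/mnm_lepP => j; rewrite mulmnE mnm1E.
  by case: eqP => [->|]; rewrite ?mul1n.
rewrite mulr0 mcoeff0; case: eqP => // e; case/eqP: km.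
by rewrite e mnmDE mulmnE mnm1E eqxx mul1n (eqP mi).
Qed.

(** This makes [unip] injective and brings univariate identities back to the multivariate ring. *)
Lemma unip_eval p : (unip p).['X_i] = p.
Proof.
elim/mpolyind: p => [|c m p _ _ IH]; first by rewrite rmorph0 horner0.
rewrite rmorphD hornerD IH /= unipZ hornerZ unipX hornerM hornerC hornerXn.
congr (_ + _); rewrite mul_mpolyC; congr (_ *: _).
rewrite mpolyXn -mpolyXD submK //; apply/mnm_lepP => j; rewrite mulmnE mnm1E.
by case: eqP => [->|]; rewrite ?mul1n.
Qed.

Lemma unip_deriv p : unip p^`M(i) = (unip p)^`().
Proof.
apply/polyP => k; apply/mpolyP => m.
rewrite coef_deriv mcoeffMn !coef_unip mcoeff_deriv.
case: ifP => [/eqP mi|]; last by rewrite mul0rn.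
by rewrite mnmDE mulmnE mnm1E eqxx mul1n mi -addmA -mulmSr.
Qed.

(** Absence of ['X_i] is put as an equation that rewrites [unip p] to a constant polynomial. *)
Definition free_of p := unip p = p%:P.

Lemma free_ofP p : free_of p <-> forall m, m i != 0%N -> p@_m = 0.
Proof.
split=> [free_p m mi|free_p].
  have := coef_unip p 0 m; rewrite free_p coefC eqxx (negPf mi) //.
apply/polyP => k; apply/mpolyP => m; rewrite coef_unip coefC.
case: ifP => [/eqP mi|/negbT/free_p pm]; last by case: ifP; rewrite ?mcoeff0.
case: k => [|k]; first by rewrite mulm0n addm0.
by rewrite mcoeff0 free_p // mnmDE mulmnE mnm1E eqxx mul1n mi.
Qed.

Lemma free_of_coef p k : free_of (unip p)`_k.
Proof. by apply/free_ofP => m mi; rewrite coef_unip (negPf mi). Qed.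

Lemma free_ofX p k : free_of p -> free_of (p ^+ k).
Proof. by rewrite /free_of rmorphXn /= => ->; rewrite polyC_exp. Qed.

Lemma unip_inj : injective unip.
Proof. by move=> p q e; rewrite -[p]unip_eval e unip_eval. Qed.

End OneVariable.

(** Ensures that variables already eliminated do not return when a leading coefficient in another
    variable is taken. *)
Lemma free_of_unip_coef n (R : comNzRingType) (i j : 'I_n) (p : {mpoly R[n]}) k :
  free_of j p -> free_of j (unip i p)`_k.
Proof.
move=> /free_ofP free_p; apply/free_ofP => m mj; rewrite coef_unip.
by case: ifP => // _; rewrite free_p // mnmDE addn_eq0 (negPf mj).
Qed.

(** * Univariate divisibility *)

(** Up to a scalar, [p] is [e * gcdp p f], and separability makes the factors coprime. Then [e] is
    coprime to [f] but divides [f ^+ k], so it is constant. Here [%|] allows nonzero scalar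
    multiples of the dividend. *)
Lemma separable_dvdp_exp (D : idomainType) (p f : {poly D}) k :
  separable.separable_poly p -> p %| f ^+ k -> p %| f.
Proof.
move=> sep_p p_fk; have [sqf _] := separable.separable_polyP sep_p.
have /Pdiv.Idomain.dvdpP[[c e] /= c0 def_p] := dvdp_gcdl p f.
have ed_p : e * gcdp p f %| p by rewrite -def_p dvdpZl.
have e_p : e %| p by apply: dvdp_trans ed_p; apply: dvdp_mulIl.
have co_ef : coprimep e f.
  apply/coprimepP => d d_e d_f; have /coprimepP := sqf _ _ ed_p; apply=> //.
  by rewrite dvdp_gcd (dvdp_trans d_e).
have e1 : e %= 1.
  have /coprimepP := coprimep_expr k co_ef; apply; first exact: dvdpp.
  exact: dvdp_trans p_fk.
rewrite -(@dvdpZl _ c) // def_p (eqp_dvdl _ (eqp_mulr _ e1)) mul1r.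
exact: dvdp_gcdr.
Qed.

(** The top coefficients show that [u] divides [lead_coef B * lead_coef H]; so after scaling [H] by
    [lead_coef B], its leading term is a multiple of [u] and can be removed. Induction on the size
    of [H] concludes. *)
Lemma dvd_mul_lead_coef (R : comNzRingType) (u : R) (B H : {poly R}) :
    (exists G, B * H = u *: G) ->
  exists M H', lead_coef B ^+ M *: H = u *: H'.
Proof.
have [s] := ubnP (size H); elim: s H => // s IH H; rewrite ltnS => le_Hs [G def_G].
have [->|H0] := eqVneq H 0; first by exists 0%N, 0; rewrite !scaler0.
have [->|B0] := eqVneq B 0.
  by exists 1%N, 0; rewrite lead_coef0 expr1 scale0r scaler0.
pose d := (size H).-1; pose b := lead_coef B.
(* The degree at which the product of the two leading coefficients occurs, even if that product
   vanishes. *)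
pose w := G`_(size B + size H).-2.
have lcBH : b * lead_coef H = u * w by rewrite mul_lead_coef def_G coefZ.
pose H1 := b *: H - (u * w) *: 'X^d.
have [||M [H' def_H']] := IH H1.
- rewrite -(ltn_predK (m := 0) (n := size H)) ?size_poly_gt0 // in le_Hs.
  apply: leq_ltn_trans le_Hs; apply/leq_sizeP => j le_dj.
  rewrite coefB !coefZ coefXn -lcBH; case: eqVneq => [->|ne_jd].
    by rewrite mulr1 -/(lead_coef H) subrr.
  rewrite nth_default ?mulr0 ?subr0 //.
  by rewrite -[size H]prednK ?size_poly_gt0 // ltn_neqAle eq_sym ne_jd.
- exists (b *: G - w *: (B * 'X^d)).
  rewrite mulrBr -!scalerAr def_G scalerBr !scalerA.
  by rewrite [b * u]mulrC.
exists M.+1, (H' + (b ^+ M * w) *: 'X^d).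
rewrite exprSr -scalerA -/b scalerDr -def_H' scalerBr.
by rewrite !scalerA [u * (_ * w)]mulrCA subrK.
Qed.

(** * Elimination of the variables from a multiplier *)

Section IteratedLeadingCoefficients.
Variables (n : nat) (D : idomainType) (p f : {mpoly D[n]}).
Implicit Types (g h b u : {mpoly D[n]}) (i j : 'I_n).

(* A multiplier of [f] into [(p)] exists over the fraction field of the other
   variables; extracting one coefficient in ['X_i] makes it free of ['X_i]. *)
Lemma free_multiplier i k g : separable.separable_poly (unip i p) ->
    f ^+ k = g * p ->
  exists2 u, u != 0 /\ free_of i u & exists h, u * f = h * p.
Proof.
move=> sep_p def_fk.
have : unip i p %| unip i f ^+ k.
  by rewrite -rmorphXn /= def_fk rmorphM dvdp_mulIr.
move/(separable_dvdp_exp sep_p)/Pdiv.Idomain.dvdpP => [[c H] /= c0 def_f].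
(* [c] and the coefficients of [H] may still involve ['X_i], but those of [unip i f] and [unip i p]
   do not. Taking the coefficient of degree [d] in ['X_i] on both sides therefore preserves the
   identity. *)
pose d := (size (unip i c)).-1.
pose u := (unip i c)`_d.
have u0 : u != 0.
  rewrite -/(lead_coef _) lead_coef_eq0; apply: contra_neq c0 => c0.
  by apply: (@unip_inj _ _ i); rewrite rmorph0.
have coef_mul_free x y : free_of i y -> (unip i (x * y))`_d = (unip i x)`_d * y.
  by move=> free_y; rewrite rmorphM /= free_y coefMC.
exists u; first by split=> //; apply: free_of_coef.
pose H' := \poly_(j < size H) (unip i H`_j)`_d.
have coefH' l : H'`_l = (unip i H`_l)`_d.
  rewrite coef_poly; case: ltnP => // le_Hl.
  by rewrite [H`_l]nth_default // rmorph0 coef0.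
have def_uf : u *: unip i f = H' * unip i p.
  apply/polyP => j; rewrite coefZ -coef_mul_free; last exact: free_of_coef.
  rewrite -coefZ def_f !coefM rmorph_sum coef_sum /=; apply: eq_bigr => l _.
  by rewrite coef_mul_free ?coefH' //; apply: free_of_coef.
exists H'.['X_i]; have := congr1 (fun F => F.['X_i]) def_uf.
by rewrite hornerZ hornerM !unip_eval.
Qed.

Hypothesis p0 : p != 0.

(** Cancelling [p] gives [b * g = u * h]. As [u] is free of ['X_i], it divides a power of the
    leading coefficient of [b] times [g]; then [u] is cancelled. *)
Lemma lead_coef_multiplier i u b g h : u != 0 -> free_of i u ->
    u * f = g * p -> b * f = h * p ->
  exists M h', lead_coef (unip i b) ^+ M * f = h' * p.
Proof.
move=> u0 free_u def_uf def_bf.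
have def_uh : b * g = u * h.
  by apply: (mulIf p0); rewrite -!mulrA -def_uf -def_bf mulrCA.
have [|M [H' def_H']] := @dvd_mul_lead_coef _ u (unip i b) (unip i g).
  by exists (unip i h); rewrite -mul_polyC -free_u -!rmorphM /= def_uh.
exists M, H'.['X_i]; apply: (mulfI u0).
have := congr1 (fun F => F.['X_i]) def_H'.
rewrite !hornerZ unip_eval => def_g.
by rewrite mulrCA def_uf mulrA def_g mulrA.
Qed.

(* Starting from [p] itself, each step replaces the multiplier by a power of its
   leading coefficient in one more variable; this replaces the usual argument
   by unique factorization. *)
Lemma const_multiplier :
    (forall i, free_of i p \/
       exists2 u, u != 0 /\ free_of i u & exists h, u * f = h * p) ->
  exists2 t : D, t != 0 & exists h, t *: f = h * p.
Proof.
move=> mult_i.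
(* The second invariant covers variables absent from [p]: they are absent from the initial
   multiplier [p] and from all later ones. *)
have [b [b0 [h def_bf] [free_b _]]] : exists b, [/\ b != 0,
    exists h, b * f = h * p &
    (forall i, i \in enum 'I_n -> free_of i b) /\
    (forall i, free_of i p -> free_of i b)].
  elim: (enum 'I_n) => [|i s [b [b0 [h def_bf] [free_s free_p]]]].
    by exists p; split=> //; exists f; rewrite mulrC.
  have [free_ip|[u [u0 free_u] [g def_uf]]] := mult_i i.
    exists b; split=> //; first by exists h.
    by split=> // j; rewrite inE => /predU1P[->|/free_s//]; apply: free_p.
  have [M [h' def_h']] := lead_coef_multiplier u0 free_u def_uf def_bf.
  exists (lead_coef (unip i b) ^+ M); split; last 1 first.
  - split=> j; last by move=> /free_p free_jb; apply/free_ofX/free_of_unip_coef.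
    rewrite inE => /predU1P[->|/free_s free_jb]; apply: free_ofX.
      exact: free_of_coef.
    exact: free_of_unip_coef.
  - rewrite expf_neq0 // lead_coef_eq0; apply: contra_neq b0 => b0.
    by apply: (@unip_inj _ _ i); rewrite rmorph0.
  - by exists h'.
have def_b : b = (b@_0)%:MP.
  apply/mpolyP => m; rewrite mcoeffC; have [->|m0] := eqVneq m 0%MM.
    by rewrite mulr1.
  rewrite mulr0; have /existsP[i mi] : [exists i, m i != 0%N].
    rewrite -negb_forall; apply: contra m0 => /forallP m0.
    by apply/eqP/mnmP => i; rewrite mnm0E; apply/eqP.
  by have /free_ofP -> := free_b i (mem_enum _ i).
exists b@_0; last by exists h; rewrite -mul_mpolyC -def_b.
by apply: contraNneq b0 => b00; rewrite def_b b00.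
Qed.

Lemma dvd_of_dvd_exp c k g : c * mleadc p = 1 ->
    (forall i, free_of i p \/ separable.separable_poly (unip i p)) ->
  f ^+ k = g * p -> exists h, f = h * p.
Proof.
move=> cp sep_p def_fk; have [|t t0 [h def_tf]] := const_multiplier.
  move=> i; case: (sep_p i) => [|sep_ip]; [by left|right].
  exact: free_multiplier sep_ip def_fk.
exact: dvd_const_multiple cp t0 def_tf.
Qed.

End IteratedLeadingCoefficients.

(** * Regrouping K[z, x] as K[x][z] *)

HB.lock Definition in_z (K : fieldType) (r s : nat) (p : {mpoly K[r + s]}) :
    {mpoly {mpoly K[s]}[r]} :=
  mmap (@mpolyC r {mpoly K[s]} \o @mpolyC s K)
    (fun i => match split i with inl j => 'X_j | inr j => ('X_j)%:MP end) p.

HB.lock Definition out_z (K : fieldType) (r s : nat)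
    (F : {mpoly {mpoly K[s]}[r]}) : {mpoly K[r + s]} :=
  mmap (@xincl K r s) (fun i => 'X_(zvar s i)) F.

Section SplitVariables.
Variables (K : fieldType) (r s : nat).
Local Notation S := {mpoly K[r + s]}.
Local Notation A := {mpoly K[s]}.
Local Notation in_z := (@in_z K r s).
Local Notation out_z := (@out_z K r s).
Implicit Types (p : S) (a : A).

Let xincl_additive : zmod_morphism (@xincl K r s).
Proof. by move=> p q; rewrite /xincl rmorphB. Qed.
Let xincl_multiplicative : monoid_morphism (@xincl K r s).
Proof. by split=> [|p q]; rewrite /xincl ?rmorph1 ?rmorphM. Qed.
HB.instance Definition _ :=
  GRing.isZmodMorphism.Build A S (@xincl K r s) xincl_additive.
HB.instance Definition _ :=
  GRing.isMonoidMorphism.Build A S (@xincl K r s) xincl_multiplicative.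

Let in_z_additive : zmod_morphism in_z.
Proof. by move=> p q; rewrite unlock rmorphB. Qed.
Let in_z_multiplicative : monoid_morphism in_z.
Proof. by split=> [|p q]; rewrite unlock ?rmorph1 ?rmorphM. Qed.
HB.instance Definition _ :=
  GRing.isZmodMorphism.Build S {mpoly A[r]} in_z in_z_additive.
HB.instance Definition _ :=
  GRing.isMonoidMorphism.Build S {mpoly A[r]} in_z in_z_multiplicative.

Let out_z_additive : zmod_morphism out_z.
Proof. by move=> p q; rewrite unlock rmorphB. Qed.
Let out_z_multiplicative : monoid_morphism out_z.
Proof. by split=> [|p q]; rewrite unlock ?rmorph1 ?rmorphM. Qed.
HB.instance Definition _ :=
  GRing.isZmodMorphism.Build {mpoly A[r]} S out_z out_z_additive.
HB.instance Definition _ :=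
  GRing.isMonoidMorphism.Build {mpoly A[r]} S out_z out_z_multiplicative.

Definition zpart (m : 'X_{1..r + s}) : 'X_{1..r} :=
  [multinom m (lshift s i) | i < r].
Definition xpart (m : 'X_{1..r + s}) : 'X_{1..s} :=
  [multinom m (rshift r j) | j < s].

Lemma mdeg_parts m : mdeg m = (mdeg (zpart m) + mdeg (xpart m))%N.
Proof.
rewrite !mdegE big_split_ord /=.
by congr (_ + _)%N; apply: eq_bigr => i _; rewrite mnmE.
Qed.

Lemma eq_parts m m' : zpart m = zpart m' -> xpart m = xpart m' -> m = m'.
Proof.
move=> ez ex; apply/mnmP => i; rewrite -(splitK i); case: (split i) => j /=.
  by have := congr1 (fun u : 'X_{1..r} => u j) ez; rewrite !mnmE.
by have := congr1 (fun u : 'X_{1..s} => u j) ex; rewrite !mnmE.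
Qed.

Definition join_parts (mu : 'X_{1..r}) (nu : 'X_{1..s}) : 'X_{1..r + s} :=
  [multinom match split i with inl j => mu j | inr j => nu j end | i < r + s].

Lemma zpart_join mu nu : zpart (join_parts mu nu) = mu.
Proof. by apply/mnmP => i; rewrite !mnmE (unsplitK (inl i)). Qed.

Lemma xpart_join mu nu : xpart (join_parts mu nu) = nu.
Proof. by apply/mnmP => i; rewrite !mnmE (unsplitK (inr i)). Qed.

Lemma in_zC c : in_z c%:MP = c%:MP%:MP.
Proof. by rewrite unlock mmapC. Qed.

Lemma in_zXl i : in_z 'X_(lshift s i) = 'X_i.
Proof. by rewrite unlock mmapX mmap1U (unsplitK (inl i)). Qed.

Lemma in_zXr j : in_z 'X_(rshift r j) = ('X_j)%:MP.
Proof. by rewrite unlock mmapX mmap1U (unsplitK (inr j)). Qed.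

Lemma in_zX m : in_z 'X_[m] = ('X_[xpart m])%:MP * 'X_[zpart m].
Proof.
rewrite mpolyXE_id rmorph_prod /= big_split_ord /= mulrC; congr (_ * _).
  rewrite mpolyXE_id rmorph_prod; apply: eq_bigr => j _.
  by rewrite !rmorphXn /= in_zXr mnmE.
by rewrite mpolyXE_id; apply: eq_bigr => i _; rewrite rmorphXn /= in_zXl mnmE.
Qed.

Lemma in_zZ c p : in_z (c *: p) = c%:MP *: in_z p.
Proof. by rewrite -mul_mpolyC rmorphM /= in_zC mul_mpolyC. Qed.

Lemma mcoeff_in_z p mu nu : (in_z p)@_mu@_nu = p@_(join_parts mu nu).
Proof.
elim/mpolyind: p => [|c m p _ _ IH]; first by rewrite rmorph0 !mcoeff0.
rewrite rmorphD !mcoeffD IH /= in_zZ in_zX; congr (_ + _).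
rewrite !mcoeffZ mcoeffCM mul_mpolyC mcoeffZ; congr (_ * _); rewrite mulrC.
have -> : 'X_[m]@_(join_parts mu nu) = (m == join_parts mu nu)%:R :> K.
  by rewrite mcoeffX.
rewrite mcoeffX; case: (eqVneq (zpart m) mu) => [<-|ne_mu].
  rewrite mul1r mcoeffX; congr (_%:R); congr nat_of_bool.
  apply/eqP/eqP => [<-|->]; last by rewrite xpart_join.
  by apply: eq_parts; rewrite ?zpart_join ?xpart_join.
rewrite mul0r mcoeff0; case: eqP => // def_m.
by rewrite def_m zpart_join eqxx in ne_mu.
Qed.

Lemma out_zC a : out_z a%:MP = xincl r a.
Proof. by rewrite unlock mmapC. Qed.

Lemma out_zX mu : out_z 'X_[mu] = \prod_i 'X_(zvar s i) ^+ mu i.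
Proof. by rewrite unlock mmapX. Qed.

Lemma xinclX nu : xincl r 'X_[nu] = \prod_j 'X_(xvar r j) ^+ nu j :> S.
Proof.
by rewrite /xincl comp_mpolyX; apply: eq_bigr => j _; rewrite tnth_mktuple.
Qed.

Lemma in_zK : cancel in_z out_z.
Proof.
elim/mpolyind => [|c m p _ _ IH]; first by rewrite !rmorph0.
rewrite !rmorphD /= IH in_zZ in_zX -mul_mpolyC !rmorphM /= !out_zC.
congr (_ + _); rewrite {1}/xincl comp_mpolyC mul_mpolyC xinclX out_zX.
congr (_ *: _); rewrite mulrC [RHS]mpolyXE_id big_split_ord /=.
by congr (_ * _); apply: eq_bigr => i _; rewrite mnmE.
Qed.

Lemma in_z_xincl a : in_z (xincl r a) = a%:MP.
Proof.
elim/mpolyind: a => [|c m a _ _ IH]; first by rewrite !rmorph0.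
rewrite !rmorphD /= IH; congr (_ + _).
rewrite {1}/xincl comp_mpolyZ -/(xincl r _) in_zZ xinclX rmorph_prod /=.
rewrite -[X in _ = X%:MP]mul_mpolyC rmorphM /= mul_mpolyC; congr (_ *: _).
rewrite mpolyXE_id rmorph_prod; apply: eq_bigr => j _.
by rewrite !rmorphXn /= in_zXr.
Qed.

End SplitVariables.

(** * Resultants and coefficient maps *)

(** The Sylvester matrix has no rows from [p] here and is scalar. *)
Lemma resultant_polyC (R : comNzRingType) (p : {poly R}) c :
  resultant p c%:P = c ^+ (size p).-1.
Proof.
have c1 : (size c%:P).-1 = 0%N by rewrite size_polyC; case: (c != 0).
rewrite /resultant (_ : Sylvester_mx p c%:P = c%:M).
  by rewrite det_scalar {1}c1.
apply/matrixP => i j; rewrite Sylvester_mxE mxE.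
case: splitP => k def_k; first by case: k def_k => k /=; rewrite {1}c1.
have {}def_k : i = k :> nat by rewrite def_k c1.
rewrite coefC -val_eqE /= def_k subn_eq0.
by case: ltngtP => // _; rewrite ?mul0rn ?mulr0n ?mulr1n.
Qed.

(** A constant [q] is allowed because the derivative is constant when [P] is linear in a variable;
    the resultant is then a positive power of [q]. *)
Lemma resultant_combination (R : comNzRingType) (p q : {poly R}) :
  (1 < size p)%N -> exists u v, (resultant p q)%:P = u * p + v * q.
Proof.
move=> p1; have [q1|/size1_polyC ->] := ltnP 1 (size q).
  by have [[u v] _ ->] := resultant_in_ideal p1 q1; exists u, v.
rewrite resultant_polyC -(subnKC p1) exprSr polyCM.
by exists 0, (q`_0 ^+ (size p - 2)%N)%:P; rewrite mul0r add0r.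
Qed.

Lemma mpoly_rmorph_ext n (R : nzRingType) (T : comNzRingType)
    (f g : {rmorphism {mpoly R[n]} -> T}) :
    (forall c, f c%:MP = g c%:MP) -> (forall i, f 'X_i = g 'X_i) -> f =1 g.
Proof.
move=> eqC eqX; elim/mpolyind => [|c m p _ _ IH]; first by rewrite !rmorph0.
rewrite !rmorphD IH -mul_mpolyC !rmorphM eqC; congr (_ * _ + _).
rewrite mpolyXE_id !rmorph_prod; apply: eq_bigr => i _.
by rewrite !rmorphXn /= eqX.
Qed.

Lemma mlead_map_mpoly n (R T : nzRingType) (f : {rmorphism R -> T})
    (p : {mpoly R[n]}) :
  f (mleadc p) != 0 -> mlead (map_mpoly f p) = mlead p.
Proof.
move=> lc; apply/eqP; rewrite Order.POrderTheory.eq_le; apply/andP; split.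
  have fp0 : map_mpoly f p != 0.
    by apply: contraNneq lc => fp0; rewrite -mcoeff_map_mpoly fp0 mcoeff0.
  apply: msupp_le_mlead; have := mlead_supp fp0; rewrite !mcoeff_msupp.
  by rewrite mcoeff_map_mpoly; apply: contra_neq => ->; apply: raddf0.
by apply: msupp_le_mlead; rewrite mcoeff_msupp mcoeff_map_mpoly.
Qed.

(** * Reduction modulo a prime of K[x] *)

Section Reduction.
Variables (K : fieldType) (r s : nat).
Local Notation S := {mpoly K[r + s]}.
Local Notation A := {mpoly K[s]}.

(** Outside (x), [P] has a monomial in z alone, of degree [d]. The order being graded, the leading
    z-monomial has degree at least [d], and homogeneity leaves no room for x in its coefficient. *)
Lemma mleadc_in_z (P : S) d : P \is d.-homog -> ~ x_ideal P ->
  exists c : A, c * mleadc (in_z P) = 1.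
Proof.
move=> homP nxP.
have [m0 m0P x0] : exists2 m, m \in msupp P & xpart m = 0%MM.
  apply: boolp.contrapT => no_m; apply: nxP.
  rewrite (mpolyE P) big_seq; elim/big_ind: _ => [||m mP].
  - exact: ideal_gen0.
  - by move=> *; apply: ideal_genD.
  have /existsP[j mj] : [exists j : 'I_s, m (xvar r j) != 0%N].
    rewrite -negb_forall; apply/negP => /forallP m0; apply: no_m.
    by exists m => //; apply/mnmP => j; rewrite mnmE mnm0E; apply/eqP/m0.
  rewrite -(submK (m := U_(xvar r j)) (m' := m)) ?lep1mP //.
  rewrite mpolyXD scalerAl; apply: ideal_gen_mem; by exists j.
pose F := in_z P; pose L := mlead F.
have F0 : F@_(zpart m0) != 0.
  apply: contraTneq m0P => F0; rewrite mcoeff_msupp negbK.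
  have -> : m0 = join_parts (zpart m0) 0%MM.
    by apply: eq_parts; rewrite ?zpart_join ?xpart_join.
  by rewrite -mcoeff_in_z -/F F0 mcoeff0.
have le_dL : (d <= mdeg L)%N.
  rewrite -(dhomog_mf homP m0P) /= mdeg_parts x0 mdeg0 addn0.
  by apply/lemc_mdeg/msupp_le_mlead; rewrite mcoeff_msupp.
have nz_lc : mleadc F != 0.
  by rewrite mleadc_eq0; apply: contraNneq F0 => ->; rewrite mcoeff0.
have def_lc : mleadc F = ((mleadc F)@_0)%:MP.
  apply/mpolyP => nu; rewrite mcoeffC; have [->|nu0] := eqVneq nu 0%MM.
    by rewrite mulr1.
  rewrite mulr0 mcoeff_in_z; apply: (dhomog_nemf_coeff homP) => /=.
  rewrite mdeg_parts zpart_join xpart_join gtn_eqF //.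
  by rewrite (leq_ltn_trans le_dL) // -addn1 leq_add2l lt0n mdeg_eq0.
exists ((mleadc F)@_0)^-1%:MP; rewrite [X in _ * X]def_lc -mpolyCM mulVf //.
by apply: contraNneq nz_lc => lc0; rewrite def_lc lc0.
Qed.

Lemma out_zE (F : {mpoly A[r]}) :
  out_z F = \sum_(m <- msupp F) out_z 'X_[m] * xincl r F@_m.
Proof.
rewrite {1}(mpolyE F) rmorph_sum; apply: eq_bigr => m _.
by rewrite -mul_mpolyC rmorphM /= out_zC mulrC.
Qed.

Section ModuloPrime.
Variables (q : {pred A}) (D : idomainType) (pr : {rmorphism A -> D}).
Hypothesis ker_pr : forall a, (pr a == 0) = (a \in q).

Let red : S -> {mpoly D[r]} := map_mpoly pr \o @in_z K r s.

Lemma kernel_reduction x : red x = 0 -> extended_ideal q x.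
Proof.
move=> x0; rewrite -(in_zK x) out_zE; apply: ideal_gen_sum => m.
apply: ideal_gen_mem; exists (in_z x)@_m => //.
have := congr1 (mcoeff m) x0; rewrite mcoeff_map_mpoly mcoeff0 -ker_pr => ->.
exact: eqxx.
Qed.

(** Both sides are ring morphisms in [x], so constants and variables suffice. *)
Lemma unip_reduction i x :
  unip i (red x) = map_poly red (uni_in (lshift s i) x).
Proof.
have <- : unip (lshift s i) x = uni_in (lshift s i) x by rewrite unlock.
apply: (mpoly_rmorph_ext (f := @unip r D i \o red)
  (g := map_poly red \o @unip (r + s) K (lshift s i))) => [c|j] /=.
  by rewrite !unipC map_polyC /= /red /= in_zC map_mpolyC unipC.
have unipXU n (R : comNzRingType) (k l : 'I_n) :
    unip k ('X_l : {mpoly R[n]}) = if l == k then 'X else ('X_l)%:P.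
  by rewrite unlock mmapX mmap1U.
rewrite unipXU -(splitK j); case: (split j) => l /=.
  rewrite /red /= in_zXl map_mpolyX unipXU (inj_eq (@lshift_inj _ _)).
  case: ifP => _; first by rewrite map_polyX.
  by rewrite map_polyC /= in_zXl map_mpolyX.
by rewrite eq_rlshift map_polyC /= /red /= in_zXr map_mpolyC unipC.
Qed.

(** The discriminant is a combination of [P] and its derivative. This identity survives reduction
    even if the degree in z_i drops, and becomes a Bezout relation with a nonzero constant. *)
Lemma separable_reduction i P : depends_on (zvar s i) P ->
  ~ extended_ideal q (Disc (zvar s i) P) ->
  separable.separable_poly (unip i (red P)).
Proof.
move=> [m mP mi] nqDisc; set p := uni_in (zvar s i) P.
have p_unip : p = unip (zvar s i) P by rewrite unlock.
have p1 : (1 < size p)%N.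
  rewrite ltnNge; apply: contraTN mP => p1; rewrite -mcoeff_eq0.
  have le_m : (U_(zvar s i) *+ m (zvar s i) <= m)%MM.
    apply/mnm_lepP => j; rewrite mulmnE mnm1E.
    by case: eqP => [->|]; rewrite ?mul1n.
  have := coef_unip (zvar s i) P (m (zvar s i)) (m - U_(zvar s i) *+ m (zvar s i)).
  rewrite submK // mnmBE mulmnE mnm1E eqxx mul1n subnn /= => <-.
  by rewrite -p_unip nth_default ?mcoeff0 // (leq_trans p1).
have def_p' : uni_in (zvar s i) P^`M(zvar s i) = p^`().
  by rewrite p_unip -unip_deriv unlock.
have [u [v def_res]] := resultant_combination p^`() p1.
rewrite separable.separable_poly.unlock; apply/Bezout_coprimepP.
exists (map_poly red u, map_poly red v) => /=.
rewrite !unip_reduction -/p deriv_map -!rmorphM -rmorphD -def_res /=.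
rewrite map_polyC /= -size_poly_eq1 size_polyC.
have -> // : red (resultant p p^`()) != 0.
apply/eqP => /kernel_reduction; rewrite -def_p'; exact: nqDisc.
Qed.

(** Modulo [q], [P] divides [f], so the image of [rho] is a reduced multiple of [P], hence zero. The
    remainder [rho] is computed before reduction and thus serves all primes at once. *)
Lemma remainder_coef_mem P f n c g rho :
    c * mleadc (in_z P) = 1 ->
    (forall i, depends_on (zvar s i) P ->
       ~ extended_ideal q (Disc (zvar s i) P)) ->
    (exists h, red (f ^+ n) = h * red P) ->
    in_z f = g * in_z P + rho -> reduced_mod (in_z P) rho ->
  forall m, rho@_m \in q.
Proof.
move=> cP discP [h def_fn] def_f red_rho.
(* An invertible leading coefficient cannot vanish modulo a prime. *)
have lead_P : mlead (red P) = mlead (in_z P).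
  apply: mlead_map_mpoly; apply/eqP => lc0.
  by have /eqP := rmorph1 pr; rewrite -cP rmorphM /= lc0 mulr0 eq_sym oner_eq0.
have c_red : pr c * mleadc (red P) = 1.
  by rewrite lead_P mcoeff_map_mpoly -rmorphM cP rmorph1.
have {}def_fn := etrans (esym (rmorphXn red n f)) def_fn.
have [|i|h' def_h'] := dvd_of_dvd_exp _ c_red _ def_fn.
- apply/eqP => P0; move/eqP: c_red.
  by rewrite P0 mcoeff0 mulr0 eq_sym oner_eq0.
- have [dep|ndep] := boolp.pselect (depends_on (zvar s i) P).
    by right; apply: separable_reduction => //; apply: discP.
  left; apply/free_ofP => m mi; rewrite mcoeff_map_mpoly.
  suff -> : (in_z P)@_m = 0 by apply: raddf0.
  apply/mpolyP => nu; rewrite mcoeff_in_z mcoeff0; apply/eqP.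
  rewrite mcoeff_eq0; apply/negP => inP; apply: ndep.
  exists (join_parts m nu) => //; rewrite lt0n.
  by have := zpart_join m nu => /mnmP/(_ i); rewrite mnmE => ->.
have def_rho : map_mpoly pr rho = (h' - map_mpoly pr g) * red P.
  rewrite mulrBl -def_h' /red /= def_f rmorphD rmorphM /=.
  by rewrite addrC addKr.
have h0 : h' - map_mpoly pr g = 0.
  apply: (reduced_mod_multiple c_red); rewrite -def_rho => m.
  rewrite mcoeff_msupp mcoeff_map_mpoly lead_P => rho_m; apply: red_rho.
  by rewrite mcoeff_msupp; apply: contra_neq rho_m => ->; apply: raddf0.
move=> m; rewrite -ker_pr -mcoeff_map_mpoly.
by apply/eqP; rewrite [map_mpoly pr rho]def_rho h0 mul0r mcoeff0.
Qed.

End ModuloPrime.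

End Reduction.

(** * Radicality from the remainder modulo all minimal primes *)

Theorem lemma1p9 (K : closedFieldType) (charK0 : [pchar K] =i pred0)
    (r s k : nat) (P : {mpoly K[r + s]}) (Q : k.-tuple {mpoly K[s]})
    (P_form : form_of_pos_degree P)
    (Q_form : forall i : 'I_k, form_of_pos_degree (tnth Q i))
    (Q_rci : reduced_complete_intersection Q)
    (P_reduced : square_free P)
    (P_notin_x : ~ @x_ideal K r s P)
    (P_disc : forall i : 'I_r, depends_on (zvar s i) P ->
       forall q : {pred {mpoly K[s]}}, minimal_prime (seq_ideal Q) q ->
         ~ extended_ideal q (Disc (zvar s i) P)) :
  radical_ideal (seq_ideal (P :: [seq xincl r f | f <- Q])).
Proof.
move=> f n fn_in; have [d _ homP] := P_form.
have [c cP] := mleadc_in_z homP P_notin_x.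
have [g [rho [def_f red_rho]]] := mpoly_division (in_z f) cP.
have rho_in m : seq_ideal Q rho@_m.
  (* A coefficient outside the radical ideal of the [Q] would be avoided by some minimal prime. *)
  apply: boolp.contrapT => /(minimal_prime_avoiding Q_rci.2) [q min_q /negP].
  have [[q_ideal q_prime Qq] _] := min_q; apply.
  have [D [pr ker_pr]] := prime_quotient q_ideal q_prime.
  apply: (remainder_coef_mem ker_pr cP _ _ def_f red_rho) => [i dep|].
    exact: P_disc.
  pose red : {rmorphism {mpoly K[r + s]} -> {mpoly D[r]}} :=
    map_mpoly pr \o @in_z K r s.
  (* Modulo [q] the generators from [Q] vanish, so only multiples of [P] remain. *)
  apply: (ideal_gen_sub (J := fun x => exists h, red x = h * red P)) fn_in.
  - by exists 0; rewrite rmorph0 mul0r.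
  - move=> x y [h def_x] [h' def_y]; exists (h + h').
    by rewrite rmorphD mulrDl def_x def_y.
  move=> b x; rewrite inE => /predU1P[->|/mapP[a Qa ->]].
    by exists (red b); rewrite rmorphM.
  have pra : pr a = 0.
    by apply/eqP; rewrite ker_pr Qq // -[a]mul1r; apply: ideal_gen_mem.
  exists 0; rewrite mul0r rmorphM; apply/eqP; rewrite mulf_eq0; apply/orP; right.
  by rewrite /= in_z_xincl map_mpolyC mpolyC_eq0; apply/eqP/pra.
rewrite -(in_zK f) def_f rmorphD rmorphM /= in_zK.
apply: ideal_genD; first by apply: ideal_gen_mem; rewrite inE eqxx.
rewrite out_zE; apply: ideal_gen_sum => m; apply: ideal_genMl.
apply: (ideal_gen_sub (J := fun a => ideal_gen _ (xincl r a))) (rho_in m).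
- by rewrite rmorph0; apply: ideal_gen0.
- by move=> x y Jx Jy; rewrite rmorphD; apply: ideal_genD.
move=> b a Qa; rewrite rmorphM; apply: ideal_gen_mem.
by rewrite inE; apply/orP; right; apply: map_f.
Qed.
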